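(* Let $S=(\mathcal A,K,(\cdot,\cdot),\pi,D,J,\chi)$ be an antilorentzian spectral spacetime of KO-dimension $n$ mod $8$ with $\pi$ faithful, and let $\beta$ be a positive time-orientation 1-form on $S$ such that $\pi(\mathcal A)^{*_\beta}=\pi(\mathcal A)$. Define $$J_\beta=\beta J,\quad \chi_\beta=-\chi,\quad D_\beta=\frac{1-i}{2}D+\frac{1+i}{2}\beta D\beta^{-1},\quad a^{*_\beta}=\pi^{-1}(\pi(a)^{*_\beta})\ (a\in\mathcal A).$$ Then $S_\beta=((\mathcal A,*_\beta),K,\langle\cdot,\cdot\rangle_\beta,\pi,D_\beta,J_\beta,\chi_\beta)$ is a real even spectral triple of KO-dimension $2-n$ mod $8$ if and only if $\beta$ is normalized, i.e. $\beta^2=1$.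
   Context: Analytical questions (domains, boundedness, compactness of resolvents) are set aside; everything is algebraic. **Krein adjoints.** On a Krein space $(K,(\cdot,\cdot))$, $\times$ denotes the adjoint: $(A^\times\phi,\psi)=(\phi,A\psi)$ for linear $A$, $(A^\times\phi,\psi)=\overline{(\phi,A\psi)}$ for antilinear $A$. **Antilorentzian spectral spacetime** of KO-dimension $k$ mod 8: a multiplet $(\mathcal A,K,(\cdot,\cdot),\pi,D,J,\chi)$ where $(K,(\cdot,\cdot))$ is a Krein space; $\mathcal A$ is a unital complex algebra, $\pi$ a representation of it on $K$; $D^\times=D$; $\chi^2=1$, $[\pi(a),\chi]=0$ for all $a\in\mathcal A$, $\chi D=-D\chi$, $\chi^\times=-\chi$; $J$ is antilinear with $J^2=\epsilon$, $JD=DJ$, $J\chi=\epsilon''\chi J$, $J^\times J=\kappa$, where $(\epsilon,\epsilon'',\kappa)=(1,1,-1),(-1,-1,-1),(-1,1,-1),(1,-1,-1)$ for $k=0,2,4,6$ respectively; and such that there exists a *positive time-orientation 1-form*, i.e. an element $\beta\in\Omega^1_D(\mathcal A,\pi)=\{\sum_i\pi(a_i)[D,\pi(b_i)]\ (\text{finite sums}),\ a_i,b_i\in\mathcal A\}$ with $\beta^\times=\beta$, $J\beta J^{-1}=-\beta$ and $\langle\cdot,\cdot\rangle_\beta:=(\cdot,\beta^{-1}\cdot)$ positive definite. $A^{*_\beta}=\beta A^\times\beta^{-1}$ is the adjoint of a linear operator $A$ with respect to $\langle\cdot,\cdot\rangle_\beta$. **Real even spectral triple** of KO-dimension $k$ mod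 8 (algebraic part, no order-0 or order-1 condition assumed): $(\mathcal A,H,\pi,D,J,\chi)$ with $\mathcal A$ an involutive unital algebra, $H$ a Hilbert space, $\pi$ a $*$-representation, $D=D^*$, $\chi=\chi^*$, $\chi^2=1$, $\chi$ commuting with $\pi(\mathcal A)$ and anticommuting with $D$, $J$ antiunitary with $J^2=\epsilon$, $JD=DJ$, $J\chi=\epsilon''\chi J$, where $(\epsilon,\epsilon'')=(1,1),(-1,-1),(-1,1),(1,-1)$ for $k=0,2,4,6$ respectively. *)

(* Defs.v *)
From mathcomp Require Import all_boot all_order all_algebra.
From mathcomp Require Import boolp classical_sets functions reals.
From mathcomp Require Export complex.

Set Implicit Arguments.
Unset Strict Implicit.
Unset Printing Implicit Defensive.

Import Order.TTheory GRing.Theory Num.Theory.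
Local Open Scope classical_set_scope.
Local Open Scope ring_scope.

(* Domains and boundedness are disregarded: an operator is an everywhere
   defined map K -> K, and its (anti)linearity is the only regularity asked. *)

Notation antilinear f := (GRing.linear_for (Num.conj \; *:%R) f).

(* Only meaningful when f is bijective. *)
Definition inverse (U : Type) (V : zmodType) (f : V -> U) : U -> V :=
  'pinv_(fun=> 0) setT f.

Section Forms.
Context {R : realType} {K : lmodType R[i]}.
Implicit Types (form : K -> K -> R[i]) (A B : K -> K) (V : {pred K}).

(* As for the Hermitian forms of MathComp, linear in the first argument.
   None of the notions below depends on which argument is the linear one. *)
Definition hermitian_form form : Prop :=
  (forall y, scalar (form ^~ y)) /\ (forall x y, form y x = (form x y)^*).

Definition positive_definite_on V form : Prop :=
  forall x, x \in V -> x != 0 -> 0 < form x x.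

(* e ranges over R[i], but 0 < e forces it to be real. *)
Definition complete_on V form : Prop :=
  forall u : nat -> K, (forall n, u n \in V) ->
    (forall e : R[i], 0 < e -> exists N, forall m n, (N <= m)%N -> (N <= n)%N ->
       form (u m - u n) (u m - u n) < e) ->
    exists2 l, l \in V &
      forall e : R[i], 0 < e -> exists N, forall n, (N <= n)%N ->
        form (u n - l) (u n - l) < e.

Definition hilbert_on V form : Prop :=
  [/\ GRing.submod_closed V, positive_definite_on V form & complete_on V form].

Definition hilbert_space form : Prop :=
  hermitian_form form /\ hilbert_on predT form.

(* Existence of a fundamental decomposition K = Kp (+) Km; the sum is direct
   because form is positive definite on Kp and negative definite on Km. *)
Definition krein_space form : Prop :=
  hermitian_form form /\
  exists Kp Km : {pred K},
    [/\ hilbert_on Kp form,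
        hilbert_on Km (fun x y => - form x y),
        forall x y, x \in Kp -> y \in Km -> form x y = 0 &
        forall z, exists2 x, x \in Kp & exists2 y, y \in Km & z = x + y].

(* B is the adjoint of the linear (resp. antilinear) operator A; it is unique
   as soon as form is nondegenerate. *)
Definition adjoint form A B : Prop := forall x y, form (B x) y = form x (A y).

Definition antiadjoint form A B : Prop :=
  forall x y, form (B x) y = (form x (A y))^*.

Definition antiunitary form A : Prop :=
  [/\ antilinear A, bijective A & forall x y, form (A x) (A y) = (form x y)^*].

End Forms.

Section Representations.
Context {R : realType} {A : algType R[i]} {K : lmodType R[i]}.
Implicit Types (pi : A -> K -> K) (D : K -> K) (star : A -> A).

Record representation pi : Prop := {
  rep_linear : forall a, linear (pi a);
  rep_linearl : forall x, linear (pi ^~ x);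
  rep_one : forall x, pi 1 x = x;
  rep_mul : forall a b x, pi (a * b) x = pi a (pi b x)
}.

(* The bimodule Omega^1_D(A, pi) of finite sums of pi(a) [D, pi(b)]. *)
Definition one_form pi D (omega : K -> K) : Prop :=
  exists s : seq (A * A), forall x,
    omega x = \sum_(p <- s) pi p.1 (D (pi p.2 x) - pi p.2 (D x)).

Definition algebra_involution star : Prop :=
  [/\ antilinear star, involutive star & forall a b, star (a * b) = star b * star a].

End Representations.

(* (epsilon, epsilon'', kappa); only even KO-dimensions are considered. *)
Definition antilorentzian_signs (k : 'Z_8) : option (int * int * int) :=
  match nat_of_ord k with
  | 0%N => Some (1, 1, -1)
  | 2%N => Some (-1, -1, -1)
  | 4%N => Some (-1, 1, -1)
  | 6%N => Some (1, -1, -1)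
  | _ => None
  end.

(* (epsilon, epsilon'') *)
Definition riemannian_signs (k : 'Z_8) : option (int * int) :=
  match nat_of_ord k with
  | 0%N => Some (1, 1)
  | 2%N => Some (-1, -1)
  | 4%N => Some (-1, 1)
  | 6%N => Some (1, -1)
  | _ => None
  end.

Section Structures.
Context {R : realType} {A : algType R[i]} {K : lmodType R[i]}.
Implicit Types (form : K -> K -> R[i]) (pi : A -> K -> K) (star : A -> A).
Implicit Types (D J chi beta : K -> K) (k : 'Z_8).

Definition form_beta form beta : K -> K -> R[i] :=
  fun x y => form x (inverse beta y).

Record positive_time_orientation form pi D J beta : Prop := {
  pto_one_form : one_form pi D beta;
  pto_adjoint : adjoint form beta beta;
  pto_J : forall x, J (beta (inverse J x)) = - beta x;
  pto_bij : bijective beta;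
  pto_pos : positive_definite_on predT (form_beta form beta)
}.

Record antilorentzian_spectral_spacetime k form pi D J chi : Prop := {
  ass_krein : krein_space form;
  ass_rep : representation pi;
  ass_D_linear : linear D;
  ass_D_adjoint : adjoint form D D;
  ass_chi_linear : linear chi;
  ass_chi_sqr : forall x, chi (chi x) = x;
  ass_chi_pi : forall a x, pi a (chi x) = chi (pi a x);
  ass_chi_D : forall x, chi (D x) = - D (chi x);
  ass_chi_adjoint : adjoint form chi (fun x => - chi x);
  ass_J_antilinear : antilinear J;
  ass_J_D : forall x, J (D x) = D (J x);
  ass_signs :
    if antilorentzian_signs k is Some (eps, eps2, kappa) then
      [/\ forall x, J (J x) = eps%:~R *: x,
          forall x, J (chi x) = eps2%:~R *: chi (J x) &
          exists2 Jx, antiadjoint form J Jx &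
                      forall x, Jx (J x) = kappa%:~R *: x]
    else False;
  ass_orientation : exists beta, positive_time_orientation form pi D J beta
}.

Record real_even_spectral_triple k star form pi D J chi : Prop := {
  rest_star : algebra_involution star;
  rest_hilbert : hilbert_space form;
  rest_rep : representation pi;
  rest_star_rep : forall a, adjoint form (pi a) (pi (star a));
  rest_D_linear : linear D;
  rest_D_adjoint : adjoint form D D;
  rest_chi_linear : linear chi;
  rest_chi_adjoint : adjoint form chi chi;
  rest_chi_sqr : forall x, chi (chi x) = x;
  rest_chi_pi : forall a x, chi (pi a x) = pi a (chi x);
  rest_chi_D : forall x, chi (D x) = - D (chi x);
  rest_J_antiunitary : antiunitary form J;
  rest_J_D : forall x, J (D x) = D (J x);
  rest_signs :
    if riemannian_signs k is Some (eps, eps2) then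
      (forall x, J (J x) = eps%:~R *: x) /\
      (forall x, J (chi x) = eps2%:~R *: chi (J x))
    else False
}.

(* S = T^{*_beta} = beta T^x beta^-1. *)
Definition adjoint_beta form beta (T S : K -> K) : Prop :=
  exists2 T', adjoint form T T' & S = beta \o T' \o inverse beta.

(* pi(A)^{*_beta} = pi(A). The inclusion from right to left also ensures that
   every pi(a) has an adjoint. *)
Definition stable_image form pi beta : Prop :=
  [set S | exists a, adjoint_beta form beta (pi a) S] = range pi.

(* a^{*_beta} = pi^-1 (pi(a)^{*_beta}); the value is unique when pi is
   injective and exists when the image of pi is stable. *)
Definition star_beta form pi beta (a : A) : A :=
  xget 0 [set b | adjoint_beta form beta (pi a) (pi b)].

Definition D_beta D beta : K -> K := fun x =>
  ((1 - 'i) / 2) *: D x + ((1 + 'i) / 2) *: beta (D (inverse beta x)).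

Definition J_beta J beta : K -> K := beta \o J.

Definition chi_beta chi : K -> K := fun x => - chi x.

End Structures.

(* Main.v *)
Require Import Defs.
From mathcomp Require Import all_boot all_order all_algebra.
From mathcomp Require Import boolp classical_sets functions reals.
From mathcomp Require Import ring lra.

Set Implicit Arguments.
Unset Strict Implicit.
Unset Printing Implicit Defensive.

Import Order.TTheory GRing.Theory Num.Theory.
Local Open Scope ring_scope.

(** One implication is read off the sign table.  Since [J beta = - beta J], the
square of [J_beta = beta J] is [- epsilon beta^2], and the passage from [n] to
[2 - n] replaces [epsilon] by [- epsilon]; the equation [J_beta^2 = - epsilon]
required of the triple therefore says exactly that [beta^2 = 1]
([normalized_of_real_even_spectral_triple]).

Conversely, let [beta^2 = 1], so that [<x, y>_beta = (x, beta y)].  The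
algebraic axioms follow from three commutation rules: [beta] anticommutes with
[chi], because [beta] is a sum of terms [pi(a) [D, pi(b)]] and [chi] commutes
with [pi] and anticommutes with [D]; it anticommutes with [J], because it is
imaginary; and [(J x, J y)] is minus the conjugate of [(x, y)], because
[kappa = -1].  The last two signs cancel in [<J_beta x, J_beta y>_beta], which
makes [J_beta] antiunitary.  The coefficients of [D_beta] are conjugate to each
other, so that both the [beta]-adjoint and the conjugation by [J_beta], which
exchange [D] and [beta D beta^-1] while conjugating the coefficients, fix it.
The map [a |-> a^{*_beta}] is an involution because adjoints for a positive
definite form are unique and [pi] is faithful
([adjoint_algebra_involution]).

The axiom that is not algebraic is the completeness of [K] for
[<., .>_beta], which holds for every positive time orientation
([form_beta_hilbert]).  A fundamental decomposition of the Krein space yields a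
symmetry [j] for which [(x, j y)] is a Hilbert inner product
([fundamental_symmetry]), and [<x, y>_beta] is the inner product of [x] with
[G y], where [G = j beta^-1].  Both [G] and its inverse [beta j] are everywhere
defined and symmetric for that inner product, hence bounded by the theorem of
Hellinger and Toeplitz ([hellinger_toeplitz]); so the two inner products have
equivalent norms and the same convergent and Cauchy sequences
([hilbert_space_change]). *)

(** * Hermitian forms *)

Section Hermitian.
Context {R : realType} {K : lmodType R[i]} {form : K -> K -> R[i]}.
Context (hform : hermitian_form form).
Implicit Types (x y z : K) (a : R[i]).

Lemma formDl x y z : form (x + y) z = form x z + form y z.
Proof. by have := hform.1 z 1 x y; rewrite /= scale1r mul1r. Qed.

Lemma form0l z : form 0 z = 0.
Proof. by apply: (addrI (form 0 z)); rewrite -formDl !addr0. Qed.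

Lemma formZl a x z : form (a *: x) z = a * form x z.
Proof. by have := hform.1 z a x 0; rewrite /= !addr0 form0l addr0. Qed.

Lemma formNl x z : form (- x) z = - form x z.
Proof. by rewrite -scaleN1r formZl mulN1r. Qed.

Lemma formBl x y z : form (x - y) z = form x z - form y z.
Proof. by rewrite formDl formNl. Qed.

Lemma formC x y : form y x = (form x y)^*.
Proof. exact: hform.2. Qed.

Lemma formDr x y z : form z (x + y) = form z x + form z y.
Proof. by rewrite formC formDl rmorphD /= -!formC. Qed.

Lemma formZr a x z : form z (a *: x) = a^* * form z x.
Proof. by rewrite formC formZl rmorphM /= -formC. Qed.

Lemma formNr x z : form z (- x) = - form z x.
Proof. by rewrite formC formNl rmorphN /= -formC. Qed.

Lemma form_real x : form x x \is Num.real.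
Proof. by apply/CrealP; rewrite -formC. Qed.

Lemma Re_formE x : (complex.Re (form x x))%:C%C = form x x.
Proof. by rewrite RRe_real ?form_real. Qed.

Lemma adjoint_sym (A B : K -> K) : adjoint form A B -> adjoint form B A.
Proof. by move=> AB x y; rewrite formC -AB -formC. Qed.

End Hermitian.

Section InnerProduct.
Context {R : realType} {K : lmodType R[i]} {form : K -> K -> R[i]}.
Context (hform : hermitian_form form).
Context (pform : positive_definite_on predT form).
Implicit Types (x y z : K) (r : R).

(** The real part of a Hermitian form is a symmetric real bilinear form with the
same quadratic form; norms, Cauchy-Schwarz and completeness only see it. *)
Definition reform x y : R := complex.Re (form x y).
Definition form_norm x : R := Num.sqrt (reform x x).

Lemma reformDl x y z : reform (x + y) z = reform x z + reform y z.
Proof. by rewrite /reform (formDl hform) raddfD. Qed.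

Lemma reformC x y : reform x y = reform y x.
Proof.
by rewrite /reform (formC hform) -[LHS]/(complex.Re (conjc (form y x))); case: form.
Qed.

Lemma reformDr x y z : reform z (x + y) = reform z x + reform z y.
Proof. by rewrite reformC reformDl !(reformC z). Qed.

Lemma reformZl r x y : reform (r%:C%C *: x) y = r * reform x y.
Proof.
rewrite /reform (formZl hform); case: (form x y) => a b /=.
by rewrite mul0r subr0.
Qed.

Lemma reformZr r x y : reform y (r%:C%C *: x) = r * reform y x.
Proof. by rewrite reformC reformZl reformC. Qed.

Lemma reformNl x y : reform (- x) y = - reform x y.
Proof. by rewrite /reform (formNl hform) raddfN. Qed.

Lemma reformNr x y : reform y (- x) = - reform y x.
Proof. by rewrite reformC reformNl reformC. Qed.

Lemma reform0l x : reform 0 x = 0.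
Proof. by rewrite /reform (form0l hform). Qed.

Lemma reform_gt0 x : x != 0 -> 0 < reform x x.
Proof.
move=> x0; have := pform isT x0.
by rewrite -(Re_formE hform) ltcR.
Qed.

Lemma reform_ge0 x : 0 <= reform x x.
Proof.
by have [->|/reform_gt0/ltW//] := eqVneq x 0; rewrite reform0l.
Qed.

(** The vector [x - (reform x y / reform y y) y] has nonnegative square
for [y != 0]. *)
Lemma CauchySchwarz_sqr x y : reform x y ^+ 2 <= reform x x * reform y y.
Proof.
have [->|y0] := eqVneq y 0.
  by rewrite !(reformC _ 0) !reform0l mulr0 expr0n.
have b0 := reform_gt0 y0.
set t := - reform x y / reform y y.
have := reform_ge0 (x + t%:C%C *: y).
rewrite !(reformDl, reformDr, reformZl, reformZr) (reformC y x) => h.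
have /(mulr_ge0 (ltW b0)) := h.
set a := reform x x in h *; set c := reform x y in t h *; set b := reform y y in b0 t h *.
suff -> : b * (a + t * c + (t * c + t * (t * b))) = a * b - c ^+ 2 by rewrite subr_ge0.
by rewrite /t; field; rewrite gt_eqF.
Qed.

Lemma form_norm_ge0 x : 0 <= form_norm x. Proof. exact: sqrtr_ge0. Qed.

Lemma form_norm_sqr x : form_norm x ^+ 2 = reform x x.
Proof. by rewrite sqr_sqrtr // reform_ge0. Qed.

Lemma CauchySchwarz_reform x y : `|reform x y| <= form_norm x * form_norm y.
Proof.
rewrite -ler_sqr ?nnegrE ?mulr_ge0 ?form_norm_ge0 //.
by rewrite real_normK ?num_real // exprMn !form_norm_sqr CauchySchwarz_sqr.
Qed.

Lemma form_norm_triangle x y : form_norm (x + y) <= form_norm x + form_norm y.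
Proof.
rewrite -ler_sqr ?nnegrE ?addr_ge0 ?form_norm_ge0 //.
rewrite sqrrD !form_norm_sqr !(reformDl, reformDr) (reformC y x).
have := le_trans (ler_norm _) (CauchySchwarz_reform x y).
by lra.
Qed.

Lemma form_normN x : form_norm (- x) = form_norm x.
Proof. by rewrite /form_norm reformNl reformNr opprK. Qed.

Lemma form_normZ r x : form_norm (r%:C%C *: x) = `|r| * form_norm x.
Proof.
by rewrite /form_norm reformZl reformZr mulrA -expr2 sqrtrM ?sqr_ge0 // sqrtr_sqr.
Qed.

Lemma form_norm0 : form_norm 0 = 0.
Proof. by rewrite /form_norm reform0l sqrtr0. Qed.

Lemma form_lt_norm_sqr x r : 0 < r -> (form x x < (r ^+ 2)%:C%C) = (form_norm x < r).
Proof.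
move=> r0; rewrite -(Re_formE hform) ltcR -[complex.Re _]form_norm_sqr.
by rewrite ltr_sqr ?nnegrE ?form_norm_ge0 ?ltW.
Qed.

Lemma posc_sqr (e : R[i]) : 0 < e -> exists2 r : R, 0 < r & e = (r ^+ 2)%:C%C.
Proof.
move=> e0; have er := RRe_real (gtr0_real e0).
exists (Num.sqrt (complex.Re e)).
  by rewrite sqrtr_gt0 -ltcR er.
by rewrite sqr_sqrtr ?er // ltW // -ltcR er.
Qed.

(** The radii of [complete_on] are complex numbers bounding squared norms; any
positive one is the square of a real radius for the norm. *)
Lemma complete_form_normP : complete_on predT form <->
  forall u : nat -> K,
    (forall r, 0 < r -> exists N, forall m n, (N <= m)%N -> (N <= n)%N ->
      form_norm (u m - u n) < r) ->
    exists l, forall r, 0 < r -> exists N, forall n, (N <= n)%N ->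
      form_norm (u n - l) < r.
Proof.
split=> [cf u cu | cf u _ cu].
  have [//|e /posc_sqr[r r0 ->]|l _ ul] := cf u.
    have [N uN] := cu r r0; exists N => m n Nm Nn.
    by rewrite form_lt_norm_sqr // uN.
  exists l => r r0; have [|N uN] := ul (r ^+ 2)%:C%C.
    by rewrite ltcR exprn_gt0.
  by exists N => n Nn; rewrite -form_lt_norm_sqr // uN.
have [r r0|l ul] := cf u.
  have [|N uN] := cu (r ^+ 2)%:C%C; first by rewrite ltcR exprn_gt0.
  by exists N => m n Nm Nn; rewrite -form_lt_norm_sqr // uN.
exists l => // e /posc_sqr[r r0 ->].
have [N uN] := ul r r0; exists N => n Nn.
by rewrite form_lt_norm_sqr // uN.
Qed.

End InnerProduct.
Arguments reform {R K} form x y.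
Arguments form_norm {R K} form x.

(** * Boundedness of symmetric operators *)

Section HilbertSpaces.
Context {R : realType} {K : lmodType R[i]}.
Implicit Types (form : K -> K -> R[i]) (G : K -> K).

Lemma geometric_small (r : R) : 0 < r -> exists n : nat, 3^-1 ^+ n < r.
Proof.
move=> r0; have := archi_boundP (ltW (_ : 0 < r^-1)).
rewrite invr_gt0 => /(_ r0); set n := Num.bound _ => rn; exists n.
rewrite exprVn invf_plt ?posrE ?exprn_gt0 //; apply: (lt_le_trans rn).
by rewrite -natrX ler_nat ltnW // ltn_expl.
Qed.

(** The sharper bound [3/2 (3^-n - 3^-(n+m))] is the one that an induction on [m]
propagates.  What matters below is that the tail from [n.+1] on
is at most half of the step [3^-n]. *)
Lemma geometric_cauchy form (u : nat -> K) :
  hermitian_form form -> positive_definite_on predT form ->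
  (forall n, form_norm form (u n.+1 - u n) = 3^-1 ^+ n) ->
  forall n m, form_norm form (u (n + m)%N - u n) <= 3 / 2 * 3^-1 ^+ n.
Proof.
move=> hf pf du n m.
suff : form_norm form (u (n + m)%N - u n) <= 3 / 2 * (3^-1 ^+ n - 3^-1 ^+ (n + m)).
  have : 0 <= 3^-1 ^+ (n + m) :> R by rewrite exprn_ge0 // invr_ge0.
  by move: (_ ^+ _) (_ ^+ _) => a b; lra.
elim: m => [|m IH]; first by rewrite addn0 !subrr mulr0 form_norm0.
have -> : u (n + m.+1)%N - u n = (u (n + m).+1 - u (n + m)%N) + (u (n + m)%N - u n).
  by rewrite addnS addrA subrK.
apply: le_trans (form_norm_triangle hf pf _ _) _; rewrite du addnS (exprS _ (n + m)).
move: IH; move: (_ ^+ _) (_ ^+ _) => a b; lra.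
Qed.

(** A gliding hump argument.  If [G] is unbounded, choose [x n] on which it
stretches by more than [(n+1) 3^n], and build [y] by adding successively
[+ e n] or [- e n], where [e n] has the direction of [G (x n)] and length
[3^-n]; the sign keeps [|(G (x n), y n.+1)|] at least [3^-n |G (x n)|].  Later
steps change the pairing by at most half of that, so the limit [l] satisfies
[3^-n |G (x n)| <= 2 |(G (x n), l)| = 2 |(x n, G l)| <= 2 |x n| |G l|], whence
[n < 2 |G l|] for all [n]. *)
Lemma hellinger_toeplitz form G : hilbert_space form -> adjoint form G G ->
  exists2 C : R, 0 < C & forall x, form_norm form (G x) <= C * form_norm form x.
Proof.
move=> [hf [_ pf /(complete_form_normP hf pf) cf]] sG; apply: contrapT => unbounded.
have /choice[x bigG] : forall n, exists x,
    n.+1%:R * 3 ^+ n * form_norm form x < form_norm form (G x).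
  move=> n; apply: contrapT => small; apply: unbounded; exists (n.+1%:R * 3 ^+ n).
    by rewrite mulr_gt0 ?exprn_gt0.
  by move=> x; rewrite leNgt; apply/negP => lt_x; apply: small; exists x.
pose d n : R := 3^-1 ^+ n.
have d_gt0 n : 0 < d n by rewrite exprn_gt0 // invr_gt0.
pose g n := G (x n).
have g_gt0 n : 0 < form_norm form (g n).
  by apply: le_lt_trans (bigG n); rewrite !mulr_ge0 ?form_norm_ge0 ?exprn_ge0.
(* The hump: the vector of norm [d n] maximizing the pairing with [g n]. *)
pose e n : K := (d n / form_norm form (g n))%:C%C *: g n.
have norm_e n : form_norm form (e n) = d n.
  rewrite form_normZ // ger0_norm ?divfK ?gt_eqF //.
  by rewrite divr_ge0 ?ltW.
have g_e n : reform form (g n) (e n) = d n * form_norm form (g n).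
  by rewrite reformZr // -form_norm_sqr // expr2 mulrA divfK ?gt_eqF.
pose step n y := if 0 <= reform form (g n) y then y + e n else y - e n.
pose y := nat_rect (fun=> K) 0 step.
have yS n : y n.+1 = step n (y n) by [].
have dy n : form_norm form (y n.+1 - y n) = d n.
  by rewrite yS /step; case: ifP => _; rewrite addrAC subrr add0r ?form_normN.
have gy : forall n, d n * form_norm form (g n) <= `|reform form (g n) (y n.+1)|.
  move=> n; have := mulr_gt0 (d_gt0 n) (g_gt0 n).
  rewrite yS /step -g_e; case: ifPn; rewrite -?ltNge !reformDr ?reformNr //.
    by move=> p q; rewrite ger0_norm ?addr_ge0 ?lerDr // ltW.
  move=> p q; rewrite ler0_norm; first by lra.
  by lra.
have y_tail := geometric_cauchy hf pf dy.
have [r r0|l yl] := cf y.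
  have [|N smallN] := @geometric_small (r / 3); first by rewrite divr_gt0.
  exists N => m n /subnKC <- /subnKC <-.
  set m' := (m - N)%N; set n' := (n - N)%N.
  have -> : y (N + m')%N - y (N + n')%N = (y (N + m')%N - y N) - (y (N + n')%N - y N).
    by rewrite opprB addrA subrK.
  apply: le_lt_trans (form_norm_triangle hf pf _ _) _; rewrite form_normN //.
  have := y_tail N m'; have := y_tail N n'; move: smallN.
  move: (_ ^+ _) => a; lra.
have y_l n : form_norm form (y n.+1 - l) <= d n / 2.
  apply/ler_addgt0Pl => r r0; have [N yN] := yl r r0.
  have -> : y n.+1 - l = (y (n.+1 + N)%N - l) - (y (n.+1 + N)%N - y n.+1).
    by rewrite opprB [RHS]addrC addrA subrK.
  apply: le_trans (form_norm_triangle hf pf _ _) _; rewrite form_normN //.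
  have := y_tail n.+1 N; have := yN _ (leq_addl n.+1 N); rewrite /d exprS.
  by move: (_ ^+ n) => a; lra.
have := archi_boundP (_ : 0 <= 2 * form_norm form (G l)).
rewrite mulr_ge0 ?form_norm_ge0 // => /(_ isT); set n := Num.bound _ => Gl_n.
have x_l : `|reform form (g n) l| <= form_norm form (x n) * form_norm form (G l).
  have -> : reform form (g n) l = reform form (x n) (G l) by congr complex.Re; exact: sG.
  exact: CauchySchwarz_reform.
have g_l : d n * form_norm form (g n) <= 2 * (form_norm form (x n) * form_norm form (G l)).
  have gyl : `|reform form (g n) (y n.+1 - l)| <= form_norm form (g n) * (d n / 2).
    apply: le_trans (CauchySchwarz_reform hf pf _ _) _.
    by rewrite ler_pM2l.
  have := gy n; have -> : y n.+1 = (y n.+1 - l) + l by rewrite subrK.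
  rewrite reformDr // => h; have := le_trans h (ler_normD _ _).
  by move: gyl x_l; lra.
have := bigG n; rewrite -/(g n).
have /ltr_pM2l <- := d_gt0 n.
have -> : d n * (n.+1%:R * 3 ^+ n * form_norm form (x n)) = n.+1%:R * form_norm form (x n).
  by rewrite /d exprVn; field; rewrite gt_eqF // exprn_gt0.
move=> /lt_le_trans /(_ g_l).
have := @form_norm_ge0 _ _ form (x n); rewrite le_eqVlt => /predU1P[<-|xn0].
  by rewrite mul0r !mulr0 ltxx.
rewrite mulrCA mulrC ltr_pM2l // => /lt_trans /(_ Gl_n).
by rewrite ltr_nat ltnNge leqW.
Qed.

(** The upper bound of the second norm is the boundedness of [G].  For the lower
one, [|x|_1^2 = (x, G (G' x))_1 = (x, G' x)_2], to which Cauchy-Schwarz for the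
second form applies, while [|G' x|_2^2 = (G' x, x)_1] is controlled by the
boundedness of [G']. *)
Lemma hilbert_space_change form1 form2 G G' :
  hilbert_space form1 -> hermitian_form form2 -> positive_definite_on predT form2 ->
  cancel G' G -> adjoint form1 G G -> adjoint form1 G' G' ->
  (forall x y, form2 x y = form1 x (G y)) -> hilbert_space form2.
Proof.
move=> H1 h2 p2 GK sG sG' E.
have [h1 [sub p1 c1]] := H1; split=> //; split=> //.
have [C C0 boundG] := hellinger_toeplitz H1 sG.
have [C' C'0 boundG'] := hellinger_toeplitz H1 sG'.
have upper x : form_norm form2 x ^+ 2 <= C * form_norm form1 x ^+ 2.
  rewrite form_norm_sqr // [reform _ _ _](congr1 _ (E x x)).
  apply: le_trans (ler_norm _) _; apply: le_trans (CauchySchwarz_reform h1 p1 _ _) _.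
  by rewrite mulrC expr2 mulrA ler_wpM2r ?form_norm_ge0.
have lower x : form_norm form1 x ^+ 2 <= C' * form_norm form2 x ^+ 2.
  have [->|x0] := eqVneq x 0; first by rewrite !form_norm0 // expr0n mulr0.
  have n0 : 0 < form_norm form1 x ^+ 2 by rewrite form_norm_sqr // reform_gt0.
  have n1 : form_norm form1 x ^+ 2 <= form_norm form2 x * form_norm form2 (G' x).
    have -> : form_norm form1 x ^+ 2 = reform form2 x (G' x).
      by rewrite form_norm_sqr // /reform E GK.
    by apply: le_trans (ler_norm _) _; exact: CauchySchwarz_reform.
  have n2 : form_norm form2 (G' x) ^+ 2 <= C' * form_norm form1 x ^+ 2.
    rewrite form_norm_sqr // /reform E GK.
    apply: le_trans (ler_norm _) _; apply: le_trans (CauchySchwarz_reform h1 p1 _ _) _.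
    by rewrite expr2 mulrA ler_wpM2r ?form_norm_ge0.
  rewrite -(ler_pM2r n0) -expr2.
  apply: (@le_trans _ _ ((form_norm form2 x * form_norm form2 (G' x)) ^+ 2)).
    by rewrite ler_sqr ?nnegrE ?mulr_ge0 ?form_norm_ge0 // ltW.
  by rewrite exprMn (mulrC C') -[leRHS]mulrA; apply: ler_wpM2l n2; exact: sqr_ge0.
have [s s0 CE] : exists2 s, 0 < s & C = s ^+ 2.
  by exists (Num.sqrt C); rewrite ?sqrtr_gt0 // sqr_sqrtr // ltW.
have [t t0 C'E] : exists2 s, 0 < s & C' = s ^+ 2.
  by exists (Num.sqrt C'); rewrite ?sqrtr_gt0 // sqr_sqrtr // ltW.
have upper1 x : form_norm form2 x <= s * form_norm form1 x.
  by rewrite -ler_sqr ?nnegrE ?mulr_ge0 ?form_norm_ge0 ?(ltW s0) // exprMn -CE.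
have lower1 x : form_norm form1 x <= t * form_norm form2 x.
  by rewrite -ler_sqr ?nnegrE ?mulr_ge0 ?form_norm_ge0 ?(ltW t0) // exprMn -C'E.
apply/(complete_form_normP h2 p2) => u cu.
have [r r0|l ul] := (complete_form_normP h1 p1).1 c1 u.
  have [|N uN] := cu (r / t); first by rewrite divr_gt0.
  exists N => m n Nm Nn; apply: le_lt_trans (lower1 _) _.
  by rewrite mulrC -ltr_pdivlMr // uN.
exists l => r r0; have [|N uN] := ul (r / s); first by rewrite divr_gt0.
exists N => n Nn; apply: le_lt_trans (upper1 _) _.
by rewrite mulrC -ltr_pdivlMr // uN.
Qed.

End HilbertSpaces.

(** * Krein spaces *)

Section KreinSpaces.
Context {R : realType} {K : lmodType R[i]}.
Implicit Types (form : K -> K -> R[i]).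

(** With [P] and [Q] the projections of a fundamental decomposition, the symmetry
is [j = P - Q]: it turns [(x, y) = (P x, P y) + (Q x, Q y)] into the sum of the
inner product of [Kp] and the opposite of the form on [Km]. *)
Lemma fundamental_symmetry form : krein_space form ->
  exists j : K -> K, [/\ linear j, involutive j, adjoint form j j &
    hilbert_space (fun x y => form x (j y))].
Proof.
move=> [hf [Kp [Km [[subp posp cplp] [subm posm cplm] orth dec]]]].
have /choice[P decP] : forall z, exists x, x \in Kp /\ z - x \in Km.
  by move=> z; have [x xp [y ym ->]] := dec z; exists x; rewrite addrAC subrr add0r.
have inB (V : {pred K}) x y : GRing.submod_closed V -> x \in V -> y \in V -> x - y \in V.
  by move=> [_ subV] xV yV; rewrite addrC -scaleN1r subV.
have uniqP x x' z : x \in Kp -> z - x \in Km -> x' \in Kp -> z - x' \in Km -> x = x'.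
  move=> xp xm x'p x'm; apply/eqP; rewrite -subr_eq0; apply/eqP.
  have dp := inB _ _ _ subp xp x'p; have := inB _ _ _ subm x'm xm.
  rewrite opprB addrC addrA subrK => dm.
  apply: contrapT => /eqP d0; have := posp _ dp d0.
  by rewrite orth // ltxx.
(* [Kp] and [Km] only meet in 0, so that [P z] is the only component of [z] in [Kp]. *)
have PE x z : x \in Kp -> z - x \in Km -> P z = x.
  by move=> xp xm; have [] := decP z; move=> *; exact: (uniqP _ _ z).
have Plin : linear P.
  move=> a u v; have [up um] := decP u; have [vp vm] := decP v; apply: PE.
    by have [_ ->] := subp.
  have -> : a *: u + v - (a *: P u + P v) = a *: (u - P u) + (v - P v).
    by rewrite scalerBr opprD addrACA.
  by have [_ ->] := subm.
have orthC x y : x \in Kp -> y \in Km -> form y x = 0.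
  by move=> xp ym; rewrite (formC hf) orth // rmorph0.
have [Q QE] : exists Q, forall z, Q z = z - P z by exists (fun z => z - P z).
have decE z : z = P z + Q z by rewrite QE addrC subrK.
have Pp z : P z \in Kp by case: (decP z).
have Qm z : Q z \in Km by rewrite QE; case: (decP z).
have formE x y : form x y = form (P x) (P y) + form (Q x) (Q y).
  rewrite {1}(decE x) {1}(decE y) (formDl hf) !(formDr hf).
  by rewrite (orth (P x) (Q y)) // (orthC (P y) (Q x)) // addr0 add0r.
pose j z := P z - Q z.
have jP z : P (j z) = P z.
  apply: PE => //; rewrite /j addrAC subrr add0r -(sub0r (Q z)).
  by apply: (inB Km) (Qm z) => //; case: subm.
have jQ z : Q (j z) = - Q z by rewrite QE jP /j addrAC subrr add0r.
have hE x y : form x (j y) = form (P x) (P y) - form (Q x) (Q y).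
  by rewrite formE jP jQ (formNr hf).
exists j.
have jlin : linear j.
  have jE z : j z = P z *+ 2 - z by rewrite /j QE opprB addrA -mulr2n.
  move=> a u v; rewrite !jE Plin mulrnDl scalerMnr opprD addrACA.
  by rewrite scalerBr.
have jj : involutive j by move=> z; rewrite {1}/j jP jQ opprK -decE.
have jadj : adjoint form j j.
  by move=> x y; rewrite hE formE jP jQ (formNl hf).
split=> //; split.
  split=> [y a u v|x y]; first exact: hf.1.
  by rewrite -jadj -(formC hf).
split=> //.
  move=> x _ x0; rewrite hE.
  have [Px0|Px0] := eqVneq (P x) 0; have [Qx0|Qx0] := eqVneq (Q x) 0.
  - by move: x0; rewrite (decE x) Px0 Qx0 addr0 eqxx.
  - by rewrite Px0 (form0l hf) add0r posm.
  - by rewrite Qx0 (form0l hf) subr0 posp.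
  - by rewrite addr_gt0 ?posp ?posm.
have Pge0 x : 0 <= form (P x) (P x).
  by have [->|x0] := eqVneq (P x) 0; rewrite ?(form0l hf) // ltW // posp.
have Qge0 x : 0 <= - form (Q x) (Q x).
  by have [->|x0] := eqVneq (Q x) 0; rewrite ?(form0l hf) ?oppr0 // ltW // posm.
have PB x y : P (x - y) = P x - P y.
  by rewrite -(scaleN1r y) addrC Plin scaleN1r addrC.
have QB x y : Q (x - y) = Q x - Q y by rewrite !QE PB !opprD addrACA.
move=> u _ cu.
have [e e0|p pp up] := cplp (P \o u) (fun n => Pp (u n)).
  have [N uN] := cu e e0; exists N => m n Nm Nn; apply: le_lt_trans (uN m n Nm Nn).
  by rewrite hE /= -PB lerDl.
have [e e0|q qm uq] := cplm (Q \o u) (fun n => Qm (u n)).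
  have [N uN] := cu e e0; exists N => m n Nm Nn; apply: le_lt_trans (uN m n Nm Nn).
  by rewrite hE /= -QB lerDr.
have Ppq : P (p + q) = p by apply: PE => //; rewrite addrAC subrr add0r.
have Qpq : Q (p + q) = q by rewrite QE Ppq addrAC subrr add0r.
exists (p + q) => // e e0.
have [|N1 uN1] := up (e / 2); first by rewrite divr_gt0.
have [|N2 uN2] := uq (e / 2); first by rewrite divr_gt0.
exists (maxn N1 N2) => n; rewrite geq_max => /andP[n1 n2].
rewrite hE PB QB Ppq Qpq [e in _ < e]splitr.
by rewrite ltrD ?uN1 ?uN2.
Qed.

End KreinSpaces.

(** * Operators and one-forms *)

(** Operators are unbundled functions; these rules serve the linear ones and the
antilinear ones alike, through the scaling [s]. *)
Section LinearFor.
Context {F : pzRingType} {U V : lmodType F} {s : GRing.Scale.law F V} {f : U -> V}.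
Context (lf : GRing.linear_for s f).

Lemma linear_forB x y : f (x - y) = f x - f y.
Proof. exact: (GRing.zmod_morphism_linear lf). Qed.

Lemma linear_for0 : f 0 = 0.
Proof. by rewrite -(subrr 0) linear_forB subrr. Qed.

Lemma linear_forN x : f (- x) = - f x.
Proof. by rewrite -(sub0r x) linear_forB linear_for0 sub0r. Qed.

Lemma linear_forD x y : f (x + y) = f x + f y.
Proof. by rewrite -{1}(opprK y) linear_forB linear_forN opprK. Qed.

Lemma linear_forZ a x : f (a *: x) = s a (f x).
Proof. exact: (GRing.scalable_linear lf). Qed.

Lemma linear_for_sum (I : Type) (r : seq I) (E : I -> U) :
  f (\sum_(i <- r) E i) = \sum_(i <- r) f (E i).
Proof. by apply: (big_morph f linear_forD linear_for0). Qed.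

End LinearFor.

Lemma bijective_inverse (U : Type) (V : zmodType) (f : V -> U) :
  bijective f -> cancel f (inverse f) /\ cancel (inverse f) f.
Proof.
move=> bf; have fK : cancel f (inverse f).
  move=> x; apply: pinvKV; rewrite ?inE // => y z _ _; exact: bij_inj.
by split=> //; case: bf => g fg gf y; rewrite -[in LHS](gf y) fK gf.
Qed.

Section OneForms.
Context {R : realType} {A : algType R[i]} {K : lmodType R[i]}.
Context { pi : A -> K -> K} {D : K -> K}.
Context (rep : representation pi) (Dlin : linear D).

Lemma one_form_linear omega : one_form pi D omega -> linear omega.
Proof.
move=> [s E] a u v; rewrite !E scaler_sumr -big_split; apply: eq_bigr => p _ /=.
rewrite (rep_linear rep p.2 a u v) !Dlin (rep_linear rep p.2 a (D u) (D v)).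
by rewrite opprD addrACA -scalerBr (rep_linear rep p.1).
Qed.

(** In [pi(a) [D, pi(b)]] the operator [chi] passes every factor but [D]. *)
Lemma one_form_anticommute (chi omega : K -> K) :
  linear chi -> (forall a x, pi a (chi x) = chi (pi a x)) ->
  (forall x, chi (D x) = - D (chi x)) ->
  one_form pi D omega -> forall x, chi (omega x) = - omega (chi x).
Proof.
move=> clin cpi cD [s E] x; rewrite !E (linear_for_sum clin) -sumrN.
apply: eq_bigr => p _ /=.
rewrite -cpi (linear_forB clin) cD -!cpi cD (linear_forN (rep_linear rep p.2)).
by rewrite -(linear_forN (rep_linear rep p.1)) opprK opprB addrC.
Qed.

End OneForms.

(** * The involution given by adjoints *)

Section AdjointInvolution.
Context {R : realType} {A : algType R[i]} {K : lmodType R[i]}.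
Context {g : K -> K -> R[i]} { pi : A -> K -> K}.
Context (hg : hermitian_form g) (pg : positive_definite_on predT g).

Lemma adjoint_unique (T S S' : K -> K) : adjoint g T S -> adjoint g T S' -> S = S'.
Proof.
move=> TS TS'; apply: funext => x; apply/eqP; rewrite -subr_eq0; apply/eqP.
apply: contrapT => /eqP /(pg isT).
by rewrite (formBl hg) TS TS' subrr ltxx.
Qed.

(** Each identity holds after applying the injective [pi], where both sides are
adjoints of the same operator. *)
Lemma adjoint_algebra_involution (star : A -> A) :
  representation pi -> injective pi ->
  (forall a, adjoint g (pi a) (pi (star a))) -> algebra_involution star.
Proof.
move=> rep inj sP; have uniq a b : adjoint g (pi a) (pi b) -> star a = b.
  by move=> ab; apply: inj; exact: adjoint_unique (sP a) ab.
split=> [c a b|a|a b]; apply: uniq => x y.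
- rewrite (rep_linearl rep) (rep_linearl rep) /=.
  by rewrite (formDl hg) (formZl hg) (formDr hg) (formZr hg) !sP.
- exact: (adjoint_sym hg (sP a)).
- by rewrite !(rep_mul rep) !sP.
Qed.

End AdjointInvolution.

(** * The form twisted by a time orientation *)

Section BetaForm.
Context {R : realType} {K : lmodType R[i]}.
Context {form : K -> K -> R[i]} {beta : K -> K}.
Context (hf : hermitian_form form) (beta_adj : adjoint form beta beta).
Context (beta_bij : bijective beta).
Local Notation g := (form_beta form beta).
Local Notation bi := (inverse beta).

Let betaK : cancel beta bi := (bijective_inverse beta_bij).1.
Let biK : cancel bi beta := (bijective_inverse beta_bij).2.

Lemma inverse_selfadjoint : adjoint form bi bi.
Proof. by move=> x y; rewrite -{1}(biK y) -beta_adj biK. Qed.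

Lemma form_beta_hermitian : hermitian_form g.
Proof.
split=> [y a u v|x y]; first exact: hf.1.
by rewrite /form_beta -(formC hf) inverse_selfadjoint.
Qed.

(** The formula [beta T^x beta^-1] does compute the adjoint for the twisted form;
conversely an adjoint [S] for the twisted form gives back the adjoint
[beta^-1 S beta] for the original one. *)
Lemma adjoint_betaP T S : adjoint_beta form beta T S <-> adjoint g T S.
Proof.
split=> [[T' TT' ->] x y|TS].
  by rewrite /form_beta /= beta_adj biK TT' inverse_selfadjoint.
exists (bi \o S \o beta) => [x y|]; last by apply: funext => x /=; rewrite !biK.
by rewrite /= inverse_selfadjoint [LHS]TS /form_beta beta_adj biK.
Qed.

(** The operator relating the twisted form to the inner product of a fundamental
symmetry [j] is [j beta^-1], with inverse [beta j]; both are symmetric for that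
inner product because [beta] and [j] are self-adjoint for the Krein form. *)
Lemma form_beta_hilbert : krein_space form -> positive_definite_on predT g ->
  hilbert_space g.
Proof.
move=> /fundamental_symmetry[j [jlin jj jadj Hj]] pg.
apply: (hilbert_space_change (G := j \o bi) (G' := beta \o j) Hj) => //.
- exact: form_beta_hermitian.
- by move=> x /=; rewrite betaK jj.
- by move=> x y /=; rewrite -jadj !jj inverse_selfadjoint.
- by move=> x y /=; rewrite beta_adj jadj.
- by move=> x y /=; rewrite jj.
Qed.

(** The operator [pi a] lies in the stable image, hence is the adjoint of some
[pi c]; by symmetry [pi c] is an adjoint of [pi a]. *)
Lemma star_betaP (A : algType R[i]) (pi : A -> K -> K) :
  stable_image form pi beta ->
  forall a, adjoint g (pi a) (pi (star_beta form pi beta a)).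
Proof.
move=> stable a; apply/adjoint_betaP.
apply: (@xgetPex _ 0 [set b | adjoint_beta form beta (pi a) (pi b)]%classic).
have : range pi (pi a) by exists a.
rewrite -stable => -[c /adjoint_betaP ca]; exists c.
by apply/adjoint_betaP; exact: (adjoint_sym form_beta_hermitian).
Qed.

End BetaForm.

(** * The spectral triple of a time orientation *)

(** In each even dimension the reflection [k |-> 2 - k] flips both signs. *)
Lemma riemannian_signs_reflect (k : 'Z_8) (e e2 kappa : int) :
  antilorentzian_signs k = Some (e, e2, kappa) ->
  [/\ riemannian_signs (2 - k) = Some (- e, - e2), kappa = -1 & e = 1 \/ e = -1].
Proof.
case: k => -[|[|[|[|[|[|[|[|//]]]]]]]] kP //= [<- <- <-];
  by split; [|by []| by [left | right]].
Qed.

Section Normalized.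
Context {R : realType} {A : algType R[i]} {K : lmodType R[i]}.
Context {n : 'Z_8} {form : K -> K -> R[i]} { pi : A -> K -> K} {D J chi : K -> K}.
Context {beta : K -> K}.
Context (HS : antilorentzian_spectral_spacetime n form pi D J chi).
Context (Hbeta : positive_time_orientation form pi D J beta).

Let hf : hermitian_form form := (ass_krein HS).1.
Let lb : linear beta := one_form_linear (ass_rep HS) (ass_D_linear HS) (pto_one_form Hbeta).

Lemma chi_beta_anticommute x : chi (beta x) = - beta (chi x).
Proof.
exact: (one_form_anticommute (ass_rep HS) (ass_chi_linear HS) (ass_chi_pi HS)
          (ass_chi_D HS) (pto_one_form Hbeta)).
Qed.

(** This is [J^x J = kappa = -1]. *)
Lemma J_isometry_opp x y : form (J x) (J y) = - (form x y)^*.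
Proof.
have := ass_signs HS; case E : antilorentzian_signs => [[[e e2] kappa]|//].
have [_ -> _] := riemannian_signs_reflect E => -[_ _ [Jx JxE JxJ]].
have := JxE (J x) y; rewrite JxJ scaleN1r (formNl hf) => H.
by rewrite -[LHS]conjCK -H rmorphN.
Qed.

Lemma J_bijective : bijective J.
Proof.
have := ass_signs HS; case E : antilorentzian_signs => [[[e e2] kappa]|//].
have [_ _ eP] := riemannian_signs_reflect E => -[JJ _ _].
have ee : (e%:~R * e%:~R : R[i]) = 1.
  by case: eP => ->; rewrite ?mulN1r ?mulr1 ?opprK.
exists (fun x => e%:~R *: J x) => x; first by rewrite JJ scalerA ee scale1r.
by rewrite (linear_forZ (ass_J_antilinear HS)) /= rmorph_int JJ scalerA ee scale1r.
Qed.

Lemma J_beta_anticommute x : J (beta x) = - beta (J x).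
Proof.
have [JK _] := bijective_inverse J_bijective.
by rewrite -(pto_J Hbeta) JK.
Qed.

Lemma J_beta_sqr x : J_beta J beta (J_beta J beta x) = - beta (beta (J (J x))).
Proof. by rewrite /J_beta /= J_beta_anticommute (linear_forN lb). Qed.

(** Since [beta] is its own inverse, the twisted form is [(x, beta y)] and [D_beta]
is [c D + c^* beta D beta] with [c = (1 - i) / 2]; each axiom is then a
computation with the commutation rules of [beta]. *)
Lemma normalized_real_even_spectral_triple :
  injective pi -> stable_image form pi beta -> (forall x, beta (beta x) = x) ->
  real_even_spectral_triple (2 - n)
    (star_beta form pi beta) (form_beta form beta) pi
    (D_beta D beta) (J_beta J beta) (chi_beta chi).
Proof.
move=> inj stable bb.
have bbij := pto_bij Hbeta; have badj := pto_adjoint Hbeta.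
have bi : inverse beta = beta.
  by apply: funext => x; rewrite -{1}(bb x) (bijective_inverse bbij).1.
have hg := form_beta_hermitian hf badj bbij.
have gE x y : form_beta form beta x y = form x (beta y) by rewrite /form_beta bi.
have DE x : D_beta D beta x =
    ((1 - 'i) / 2) *: D x + ((1 + 'i) / 2) *: beta (D (beta x)) by rewrite /D_beta bi.
have starP := star_betaP hf badj bbij stable.
have conj_c : ((1 - 'i) / 2)^* = (1 + 'i) / 2 :> R[i].
  by rewrite rmorphM fmorphV rmorphB rmorph1 rmorph_nat /= conjCi opprK.
have conj_c' : ((1 + 'i) / 2)^* = (1 - 'i) / 2 :> R[i].
  by rewrite -conj_c conjCK.
have Dadj := ass_D_adjoint HS; have chi_b := chi_beta_anticommute.
have Jb := J_beta_anticommute.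
have lD := ass_D_linear HS; have lchi := ass_chi_linear HS.
have lJ := ass_J_antilinear HS.
split.
- exact: (adjoint_algebra_involution hg (pto_pos Hbeta) (ass_rep HS) inj starP).
- exact: (form_beta_hilbert hf badj bbij (ass_krein HS) (pto_pos Hbeta)).
- exact: (ass_rep HS).
- exact: starP.
- move=> a u v; rewrite !DE lb !lD lb !scalerDr !scalerA addrACA.
  by rewrite !(mulrC a).
- move=> x y; rewrite !gE !DE (linear_forD lb) !(linear_forZ lb) /= bb.
  rewrite (formDl hf) (formDr hf) !(formZl hf) !(formZr hf) conj_c conj_c' addrC.
  by rewrite badj bb !Dadj badj.
- move=> a u v; by rewrite /chi_beta lchi opprD scalerN.
- move=> x y; rewrite !gE /chi_beta [LHS](ass_chi_adjoint HS).
  by rewrite chi_b (linear_forN lb).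
- by move=> x; rewrite /chi_beta (linear_forN lchi) opprK (ass_chi_sqr HS).
- move=> a x; rewrite /chi_beta (linear_forN (rep_linear (ass_rep HS) a)).
  by rewrite (ass_chi_pi HS).
- move=> x; rewrite /chi_beta !DE (linear_forD lchi) !(linear_forZ lchi) /=.
  rewrite chi_b !(ass_chi_D HS) chi_b !(linear_forN lD, linear_forN lb).
  by rewrite !opprK !scalerN opprD !opprK.
- split.
  + move=> a u v; by rewrite /J_beta /= lJ /= lb.
  + exact: bij_comp bbij J_bijective.
  + move=> x y; rewrite !gE /J_beta /= bb badj.
    by rewrite -[beta (J y)]opprK -Jb (formNr hf) J_isometry_opp opprK.
- move=> x; rewrite /J_beta /= !DE.
  rewrite (linear_forD lJ) !(linear_forZ lJ) /= conj_c conj_c'.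
  rewrite Jb !(ass_J_D HS) Jb (linear_forN lD) (linear_forN lb) opprK.
  by rewrite (linear_forD lb) !(linear_forZ lb) /= !bb addrC.
have := ass_signs HS; case E : antilorentzian_signs => [[[e e2] kappa]|//].
have [-> _ _] := riemannian_signs_reflect E => -[JJ Jchi _].
split=> x.
  by rewrite J_beta_sqr JJ bb rmorphN scaleNr.
rewrite /J_beta /chi_beta /=.
rewrite (linear_forN lJ) Jchi (linear_forN lb) (linear_forZ lb) /= chi_b.
by rewrite rmorphN opprK scaleNr.
Qed.

Lemma normalized_of_real_even_spectral_triple star D' chi' :
  real_even_spectral_triple (2 - n) star (form_beta form beta) pi D' (J_beta J beta) chi' ->
  forall x, beta (beta x) = x.
Proof.
move=> T x; have := rest_signs T; have := ass_signs HS.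
case E : antilorentzian_signs => [[[e e2] kappa]|//].
have [-> _ eP] := riemannian_signs_reflect E => -[JJ _ _].
move=> [/(_ x) + _]; rewrite J_beta_sqr JJ rmorphN scaleNr => /oppr_inj.
by case: eP => ->; rewrite ?scaleN1r ?scale1r ?(linear_forN lb) // => /oppr_inj.
Qed.

End Normalized.

Theorem proposition3 (R : realType) (A : algType R[i]) (K : lmodType R[i])
    (n : 'Z_8) (form : K -> K -> R[i]) (pi : A -> K -> K) (D J chi : K -> K)
    (HS : antilorentzian_spectral_spacetime n form pi D J chi)
    (Hpi : injective pi)
    (beta : K -> K) (Hbeta : positive_time_orientation form pi D J beta)
    (Hstable : stable_image form pi beta) :
  real_even_spectral_triple (2 - n)
    (star_beta form pi beta) (form_beta form beta) pi
    (D_beta D beta) (J_beta J beta) (chi_beta chi)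
  <-> (forall x, beta (beta x) = x).
Proof.
split; first exact: (normalized_of_real_even_spectral_triple HS Hbeta).
exact: (normalized_real_even_spectral_triple HS Hbeta).
Qed.
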